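(* Let $\phi \colon \mathbb{N} \to (0,\infty)$ be a non-decreasing function such that $\phi(n+1)-\phi(n) \to \infty$ as $n \to \infty$. Let $$E(\phi) := \left\{ x \in (0,1] : \lim_{n\to\infty} \frac{\log d_n(x)}{\phi(n)} = 1 \right\} \quad\text{and}\quad \xi := \limsup_{n\to\infty} \frac{\phi(n+1)}{\sum_{k=1}^n \phi(k)}.$$ Then $$\dim_H E(\phi) = (1+\xi)^{-1}.$$
   Context: Pierce expansion digits: for $x \in (0,1]$ put $d_1(x) := \lfloor 1/x \rfloor$ and $T(x) := 1 - d_1(x)x$, and for $k \in \mathbb{N}$ put $d_k(x) := d_1(T^{k-1}(x))$ provided $T^{k-1}(x) \neq 0$. All digits $d_k(x)$, $k \in \mathbb{N}$, are defined exactly when $x$ is irrational, and then they form a strictly increasing sequence of positive integers. Convention: a limiting condition on $(d_n(x))_n$, or a condition for all (large) $n$, is only considered for irrational $x$, so rational $x$ do not belong to sets defined by such conditions. $\mathbb{N}=\{1,2,\dots\}$, $\log$ is the natural logarithm, $\dim_H$ is the Hausdorff dimension; $\xi$ may be $\infty$, with the conventions $1+\infty=\infty$ and $\infty^{-1}=0$. *)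

(* Defs.v *)
From HB Require Import structures.
From mathcomp Require Import all_boot all_order all_algebra.
From mathcomp Require Import all_classical all_reals all_analysis.

Set Implicit Arguments.
Unset Strict Implicit.
Unset Printing Implicit Defensive.

Import Order.TTheory GRing.Theory Num.Theory.
Import numFieldNormedType.Exports.

Local Open Scope classical_set_scope.
Local Open Scope ring_scope.

Section hausdorff.
Context {R : realType}.
Implicit Types (U A : set R) (s delta : R).
Local Open Scope ereal_scope.

(* [diam set0 = -oo]; nonempty sets have a nonnegative, possibly infinite,
   diameter. *)
Definition diam U : \bar R :=
  ereal_sup ((fun xy : R * R => `|xy.1 - xy.2|%:E) @` (U `*` U)).

(* The empty set has weight 0 also when [s = 0], whereas a singleton has weight
   [0 `^ 0 = 1] in that case. *)
Definition diam_pow s U : \bar R :=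
  if pselect (U = set0) then 0 else diam U `^ s.

(* Countable covers by arbitrary sets; finite covers are included by padding
   with [set0]. *)
Definition delta_cover delta A : set (nat -> set R) :=
  [set U | A `<=` \bigcup_i U i /\ forall i, diam (U i) <= delta%:E].

Definition hausdorff_premeasure s delta A : \bar R :=
  ereal_inf [set \sum_(0 <= i <oo) diam_pow s (U i) | U in delta_cover delta A].

Definition hausdorff_measure s A : \bar R :=
  ereal_sup [set hausdorff_premeasure s delta A
            | delta in [set delta : R | (0 < delta)%R]].

Definition hausdorff_dim A : \bar R :=
  ereal_inf [set s%:E
            | s in [set s : R | (0 <= s)%R /\ hausdorff_measure s A = 0]].

End hausdorff.

Section pierce.
Context {R : realType}.
Implicit Types (x : R) (k n : nat) (phi : nat -> R).

Definition pierce_digit1 x : int := Num.floor (1 / x).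

Definition pierce_map x : R := 1 - (pierce_digit1 x)%:~R * x.

(* Digits are numbered from [k = 1]. The definition is total: the value is
   meaningful only if [k >= 1] and the first [k - 1] iterates of [pierce_map]
   on [x] do not vanish, which holds for all [k >= 1] when [x] is irrational
   in ]0, 1]. *)
Definition pierce_digit k x : int := pierce_digit1 (iter k.-1 pierce_map x).

(* The condition involves all large digits, so only irrational numbers are
   eligible. *)
Definition pierce_E phi : set R :=
  [set x : R | 0 < x <= 1 /\ irrational x /\
    ln (pierce_digit n x)%:~R / phi n @[n --> \oo] --> (1 : R)].

(* The term [n = 0], where the sum is empty, does not affect the limsup. *)
Definition pierce_xi phi : \bar R :=
  limn_esup (fun n => (phi n.+1 / \sum_(1 <= k < n.+1) phi k)%:E).

End pierce.

(* Main.v *)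
Require Import Defs.
From HB Require Import structures.
From mathcomp Require Import all_boot all_order all_algebra.
From mathcomp Require Import all_classical all_reals all_analysis.
From mathcomp Require Import lra ring zify.
Import Order.TTheory GRing.Theory Num.Theory.
Import numFieldNormedType.Exports.
Local Open Scope classical_set_scope.
Local Open Scope ring_scope.

(** Write psi_d y = (1 - y) / d for the inverse branches of the Pierce map T,
    phi for the given function and S_n = phi 1 + ... + phi n, so that
    S_(n+1) / S_n has limsup 1 + xi. A point of E has digits d_k close to
    exp (phi k) on the logarithmic scale, and the part of E in its cylinder of
    order n lies in an interval of length 1 / (d_1 ... d_n d_(n+1)), about
    exp (- S_(n+1)); there are about exp S_n such cylinders. The critical
    exponent s balances S_n against s S_(n+1), which gives s = 1 / (1 + xi).

    Both bounds are proved for the Hausdorff content, the outer measure obtained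
    from covers of arbitrary mesh. It vanishes exactly when the Hausdorff
    measure does (for positive exponents) and, unlike the latter at fixed mesh,
    it scales exactly under affine maps.

    Upper bound. The set of points whose digits all lie in prescribed windows
    is covered by affine copies, one per admissible first digit, of the set of
    the same kind with the windows shifted by one ([content_digit_box_step]).
    Iterating this inequality and bounding the last content by a diameter gives
    [content_digit_box]; along indices where S_(n+1) / S_n is close to 1 + xi
    the bound tends to 0. As inverse images under T of sets of content 0 have
    content 0, the finitely many first digits, on which the limit says nothing,
    do no harm.

    Lower bound. Allow as k-th digit the a_k integers of [a_k, 2 a_k), where
    a_k is about exp (phi k), and let mass be the uniform distribution on the
    resulting Cantor set. A mass distribution principle is proved by hand,
    without constructing a measure: [mass n j U] is the proportion of words of
    length j whose cylinder meets U. If countably many sets have small total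
    mass, at varying depths, then digits can be chosen one by one so that the
    total conditional mass never grows, and the resulting point avoids all these
    sets ([escape_small_mass]). On the other hand a set of diameter r has mass
    at most a constant times r to the power s ([frostman_bound]), since distinct
    branches are separated by definite gaps. Hence no cover of the Cantor set
    has a small s-sum, and the Cantor set, after prefixing finitely many digits,
    sits in E. *)

(** * Hausdorff content *)

Section content.
Context {R : realType}.
Implicit Types (U A : set R) (s r c : R).
Local Open Scope ereal_scope.

Lemma diam_leP U (r : R) :
  diam U <= r%:E <-> (forall x y, U x -> U y -> (`|x - y| <= r)%R).
Proof.
split=> [Ur x y Ux Uy|Ur].
  rewrite -lee_fin; apply: le_trans Ur; apply: ereal_sup_ubound.
  by exists (x, y).
by apply: ge_ereal_sup => _ [[x y] /= [Ux Uy] <-]; rewrite lee_fin; exact: Ur.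
Qed.

Lemma diam_ge0 U : U !=set0 -> 0 <= diam U.
Proof.
move=> [x Ux]; apply: ereal_sup_ubound; exists (x, x) => //=.
by rewrite subrr normr0.
Qed.

Lemma diam_pow0 s : diam_pow s (@set0 R) = 0.
Proof. by rewrite /diam_pow; case: pselect. Qed.

Lemma diam_powE s U : U !=set0 -> diam_pow s U = diam U `^ s.
Proof. by move=> /set0P/eqP U0; rewrite /diam_pow; case: pselect. Qed.

Lemma diam_pow_ge0 s U : 0 <= diam_pow s U.
Proof. by rewrite /diam_pow; case: pselect => // ?; exact: poweR_ge0. Qed.

Lemma diam_pow_le s U r : (0 <= s)%R -> (0 <= r)%R ->
  (forall x y, U x -> U y -> (`|x - y| <= r)%R) -> diam_pow s U <= (r `^ s)%:E.
Proof.
move=> s0 r0 /diam_leP Ur.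
have [->|/set0P U0] := eqVneq U set0; first by rewrite diam_pow0 lee_fin powR_ge0.
rewrite diam_powE// -poweR_EFin gt0_ler_poweR// in_itv/= leey andbT.
  exact: diam_ge0.
by rewrite lee_fin.
Qed.

Lemma diam_pow_affine s U (a b : R) : (0 <= s)%R -> a != 0%R ->
  diam_pow s [set y | U (a * y + b)%R] <= (`|a| `^ (- s))%:E * diam_pow s U.
Proof.
move=> s0 a0; set V := [set y | _].
have [V0|/set0P V0] := eqVneq V set0.
  by rewrite V0 diam_pow0 mule_ge0 ?diam_pow_ge0// lee_fin powR_ge0.
have U0 : U !=set0 by case: V0 => y Vy; exists (a * y + b)%R.
have a1 : (0 < `|a|)%R by rewrite normr_gt0.
rewrite !diam_powE//.
have : diam V <= (`|a|^-1)%:E * diam U.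
  apply: ge_ereal_sup => _ [[x y] /= [Vx Vy] <-].
  rewrite -(@lee_pmul2l _ `|a|%:E)// muleA -!EFinM divff ?gt_eqF// mul1e.
  rewrite -normrM mulrBr; apply: ereal_sup_ubound.
  exists (a * x + b, a * y + b)%R => //=.
  by congr (_%:E); congr (`| _ |)%R; ring.
move=> VU; apply: (@le_trans _ _ (((`|a|^-1)%:E * diam U) `^ s)).
  rewrite gt0_ler_poweR// in_itv/= leey andbT; first exact: diam_ge0.
  by rewrite mule_ge0 ?lee_fin ?invr_ge0// diam_ge0.
rewrite poweRM ?lee_fin ?invr_ge0// ?diam_ge0//.
by rewrite poweR_EFin -powR_inv1// -powRrM mulN1r.
Qed.

(** The construction of an outer measure from a set function is stated for
    covers by measurable sets; declaring every set measurable turns it into the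
    construction with arbitrary covers. *)
Definition hausdorff_content s : set R -> \bar R :=
  @mu_ext _ (g_sigma_algebraType [set: set R]) R (diam_pow s).

Lemma contentE s A : hausdorff_content s A =
  ereal_inf [set \sum_(0 <= i <oo) diam_pow s (U i) |
             U in [set U : nat -> set R | A `<=` \bigcup_i U i]].
Proof.
rewrite /hausdorff_content /mu_ext; congr ereal_inf; apply/seteqP; split => x [U] /=.
  by move=> [_ AU] <-; exists U.
by move=> AU <-; exists U => //; split => // i; exact: sub_gen_smallest.
Qed.

HB.instance Definition _ s := isOuterMeasure.Build R R (hausdorff_content s)
  (@mu_ext0 _ (g_sigma_algebraType [set: set R]) R _ (diam_pow0 s)
     (diam_pow_ge0 s))
  (@mu_ext_ge0 _ (g_sigma_algebraType [set: set R]) R _ (diam_pow_ge0 s))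
  (@le_mu_ext _ (g_sigma_algebraType [set: set R]) R (diam_pow s))
  (@mu_ext_sigma_subadditive _ (g_sigma_algebraType [set: set R]) R _
     (diam_pow_ge0 s)).

Lemma content_le_diam s A r : (0 <= s)%R -> (0 <= r)%R ->
  (forall x y, A x -> A y -> (`|x - y| <= r)%R) -> hausdorff_content s A <= (r `^ s)%:E.
Proof.
move=> s0 r0 Ar; rewrite contentE; apply: ge_ereal_inf.
exists (diam_pow s A); last exact: diam_pow_le.
exists (fun i => if i is 0%N then A else set0); first by move=> x Ax; exists 0%N.
rewrite nneseries_recl//; last by move=> k _; exact: diam_pow_ge0.
by rewrite eseries_cond/= eseries0 ?adde0// => -[|]//= k _ _; rewrite diam_pow0.
Qed.

(** Taking inverse images of the members of a cover is enough, because an affine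
    map multiplies all diameters by the same factor. *)
Lemma content_affine s A (a b : R) : (0 <= s)%R -> a != 0%R ->
  hausdorff_content s [set y | A (a * y + b)%R] <= (`|a| `^ (- s))%:E * hausdorff_content s A.
Proof.
move=> s0 a0; set k := (`|a| `^ (- s))%R.
have k0 : (0 < k)%R by rewrite powR_gt0// normr_gt0.
rewrite -(@lee_pmul2l _ (k^-1)%:E) ?lte_fin ?invr_gt0// muleA -EFinM.
rewrite mulVf ?gt_eqF// mul1e [leRHS]contentE; apply: le_ereal_inf_tmp.
move=> _ [U AU <-].
rewrite -(@lee_pmul2l _ k%:E)// muleA -EFinM divff ?gt_eqF// mul1e.
rewrite -nneseriesZl => [|i _]; last exact: diam_pow_ge0.
rewrite contentE; apply: ge_ereal_inf.
exists (\sum_(0 <= i <oo) diam_pow s [set y | U i (a * y + b)%R]).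
  by exists (fun i => [set y | U i (a * y + b)%R]) => // y /= /AU[i _ Ui]; exists i.
apply: lee_nneseries => [i _ _|i _]; first exact: diam_pow_ge0.
exact: diam_pow_affine.
Qed.

Lemma content_bigcup0 s (F : nat -> set R) :
  (forall i, hausdorff_content s (F i) = 0) -> hausdorff_content s (\bigcup_i F i) = 0.
Proof.
move=> F0; apply/eqP; rewrite eq_le outer_measure_ge0 andbT.
apply: (le_trans (outer_measure_sigma_subadditive (hausdorff_content s) F)).
by rewrite eseries0// => i _ _; exact: F0.
Qed.

Lemma content0P s A : hausdorff_content s A = 0 <-> (forall e, (0 < e)%R ->
  exists2 U : nat -> set R, A `<=` \bigcup_i U i &
    \sum_(0 <= i <oo) diam_pow s (U i) < e%:E).
Proof.
split=> [A0 e e0|Ae].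
  have : hausdorff_content s A < e%:E by rewrite A0 lte_fin.
  by rewrite contentE => /ereal_inf_lt[_ [U AU <-] ?]; exists U.
apply/eqP; rewrite eq_le outer_measure_ge0 andbT; apply/lee_addgt0Pr => e e0.
have [U AU /ltW Ue] := Ae e e0.
by rewrite add0e contentE; apply: ge_ereal_inf; eexists; [exists U|exact: Ue].
Qed.

(** Each term of a cover of small total weight is itself small, which bounds the
    diameters: the mesh condition is automatic when the exponent is positive. *)
Lemma content0_hausdorff0 s A : (0 < s)%R ->
  hausdorff_content s A = 0 -> hausdorff_measure s A = 0.
Proof.
move=> s0 /content0P A0; apply/eqP; rewrite eq_le; apply/andP; split.
  apply: ge_ereal_sup => _ [d /= d0 <-]; apply/lee_addgt0Pr => e e0.
  rewrite add0e.
  (* Total weight below d `^ s forces every diameter below d. *)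
  have m0 : (0 < Num.min e (d `^ s))%R by rewrite lt_min e0 powR_gt0.
  have [U AU Ue] := A0 _ m0.
  apply: ge_ereal_inf; eexists; last first.
    by apply: (ltW (lt_le_trans Ue _)); rewrite lee_fin ge_min lexx.
  exists U => //; split => // i.
  have [->|/set0P Ui0] := eqVneq (U i) set0.
    by apply/diam_leP => x y [].
  have Uid : diam (U i) `^ s < d%:E `^ s.
    rewrite poweR_EFin -diam_powE//; apply: (@lt_le_trans _ _ _ _ _ _).
      apply: le_lt_trans Ue; rewrite (@nneseriesD1 _ _ i xpredT)//.
        by rewrite leeDl// nneseries_ge0// => k _ _; exact: diam_pow_ge0.
      by move=> k _; exact: diam_pow_ge0.
    by rewrite lee_fin ge_min lexx orbT.
  rewrite leNgt; apply/negP => dU; move: Uid; rewrite ltNge; apply/negP/negPn.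
  apply: (gt0_ler_poweR (ltW s0) _ _ (ltW dU)); rewrite in_itv/= leey andbT.
    by rewrite lee_fin ltW.
  exact: diam_ge0.
apply: le_ereal_sup_tmp; exists (hausdorff_premeasure s 1 A); first by exists 1%R => /=.
apply: le_ereal_inf_tmp => _ [U _ <-].
by apply: nneseries_ge0 => i _ _; exact: diam_pow_ge0.
Qed.

Lemma hausdorff0_content0 s A : hausdorff_measure s A = 0 -> hausdorff_content s A = 0.
Proof.
move=> A0; apply/eqP; rewrite eq_le outer_measure_ge0 andbT -A0.
apply: le_ereal_sup_tmp; exists (hausdorff_premeasure s 1 A); first by exists 1%R => /=.
rewrite contentE; apply: ereal_inf_le_tmp => _ [U [AU _] <-].
by exists U.
Qed.

End content.

(** * The Pierce map on irrational numbers *)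

Section pierce_dynamics.
Context {R : realType}.
Implicit Types (x y : R) (k n d : nat).

Lemma pierce_digit1_eq x d : 0 < x -> d%:R * x <= 1 < d.+1%:R * x ->
  pierce_digit1 x = d.
Proof.
move=> x0 /andP[dx xd]; apply: floor_def.
have -> : (d%:Z + 1)%:~R = d.+1%:R :> R by rewrite -natr1 intrD.
by rewrite -pmulrn ler_pdivlMr// ltr_pdivrMr// dx.
Qed.

Lemma pierce_digit1P x : 0 < x -> exists d : nat,
  pierce_digit1 x = d /\ d%:R * x <= 1 < d.+1%:R * x.
Proof.
move=> x0; have ix0 : 0 <= 1 / x by rewrite divr_ge0// ltW.
exists (Num.truncn (1 / x)).
have /andP[d1 d2] := truncn_itv ix0.
have H : (Num.truncn (1 / x))%:R * x <= 1 < (Num.truncn (1 / x)).+1%:R * x.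
  by rewrite -ler_pdivlMr// -ltr_pdivrMr// d1.
by split => //; exact: pierce_digit1_eq.
Qed.

Lemma pierce_digit1_gt0 x : 0 < x <= 1 -> exists d : nat,
  pierce_digit1 x = d.+1 /\ d.+1%:R * x <= 1 < d.+2%:R * x.
Proof.
move=> /andP[x0 x1]; have [[|d] [xd dx]] := pierce_digit1P _ x0.
  by move: dx; rewrite mul1r ltNge x1 andbF.
by exists d.
Qed.

(** On irrational points the map never reaches 0, since it is given locally by
    an affine map with integer coefficients. *)
Lemma irrational_pierce_map x : 0 < x <= 1 -> irrational x ->
  0 < pierce_map x <= 1 /\ irrational (pierce_map x).
Proof.
move=> x01 irrx; have [d [xd /andP[dx _]]] := pierce_digit1_gt0 _ x01.
have d0 : d.+1%:R != 0 :> R by rewrite pnatr_eq0.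
have irrT : irrational (pierce_map x).
  move=> [q _ qE]; apply: irrx; exists ((1 - q) / d.+1%:R) => //.
  rewrite fmorph_div rmorphB/= rmorph1 ratr_nat qE /pierce_map xd.
  by rewrite -pmulrn opprB addrC subrK mulrC mulKf.
split => //; have := x01; rewrite /pierce_map xd -pmulrn => /andP[x0 x1].
rewrite lt_neqAle subr_ge0 dx andbT lerBlDl lerDr mulr_ge0 ?ltW// andbT.
apply/eqP => T0; apply: irrT; exists 0 => //.
by rewrite rmorph0 /pierce_map xd -pmulrn.
Qed.

Lemma irrational_iter_pierce_map n x : 0 < x <= 1 -> irrational x ->
  0 < iter n pierce_map x <= 1 /\ irrational (iter n pierce_map x).
Proof.
move=> x01 irrx; elim: n => [//|n [IH1 IH2]]; exact: irrational_pierce_map.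
Qed.

End pierce_dynamics.

(** * Contents of sets with digits in prescribed windows *)

Section upper_bound.
Context {R : realType}.
Implicit Types (x y s : R) (lo hi : nat -> R) (n : nat).

(** The index n is the amount by which the windows are shifted: for a point x,
    the n-th iterate of x belongs to this set when the digits of x from number
    n + 1 on lie in their windows. *)
Definition digit_box lo hi n : set R :=
  [set y | [/\ 0 < y <= 1, irrational y &
    forall i, lo (n + i).+1 <= (pierce_digit i.+1 y)%:~R <= hi (n + i).+1]].

(** Self-similarity: removing the first digit d applies the affine map
    y |-> 1 - d y and shifts the windows. *)
Lemma digit_box_head lo hi n y : 0 < lo n.+1 -> digit_box lo hi n y ->
  exists d : nat, [/\ lo n.+1 <= d.+1%:R <= hi n.+1,
    d.+1%:R * y <= 1 & digit_box lo hi n.+1 (- d.+1%:R * y + 1)].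
Proof.
move=> lo0 [y01 irry yb]; have [d [yd /andP[dy _]]] := pierce_digit1_gt0 _ y01.
have Ty : pierce_map y = - d.+1%:R * y + 1.
  by rewrite /pierce_map yd -pmulrn addrC mulNr.
exists d; split=> //; first by have := yb 0%N; rewrite addn0 /pierce_digit/= yd.
rewrite -Ty; have [T01 irrT] := irrational_pierce_map _ y01 irry.
split => // i; have := yb i.+1.
by rewrite addnS addSn /pierce_digit/= -iterS iterSr.
Qed.

(** A first digit at least [lo n.+1] confines the point to the interval of
    length [(lo n.+1)^-1] next to 0. This crude bound is what makes the digit
    n + j + 1 count in the length of the cylinders of order j. *)
Lemma content_digit_box_start s lo hi n : 0 <= s -> 0 < lo n.+1 ->
  (hausdorff_content s (digit_box lo hi n) <= (lo n.+1 `^ (- s))%:E)%E.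
Proof.
move=> s0 lo0.
have bnd y : digit_box lo hi n y -> 0 < y <= (lo n.+1)^-1.
  move=> yb; have [d [/andP[lod _] dy _]] := digit_box_head _ _ _ _ lo0 yb.
  have [/andP[y0 _] _ _] := yb; rewrite y0/= -[leRHS]mul1r ler_pdivlMr//.
  by rewrite mulrC (le_trans _ dy)// ler_pM2r.
rewrite -mulN1r powRrM powR_inv1 ?(ltW lo0)//; apply: content_le_diam => //.
  by rewrite invr_ge0 ltW.
move=> x y /bnd/andP[x0 x1] /bnd/andP[y0 y1].
by rewrite ler_norml; apply/andP; split; lra.
Qed.

(** There are at most [hi n.+1] affine copies, each contracted by at least
    [lo n.+1]. *)
Lemma content_digit_box_step s lo hi n : 0 <= s -> 0 < lo n.+1 ->
  0 <= hi n.+1 ->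
  (hausdorff_content s (digit_box lo hi n) <=
   (hi n.+1 * lo n.+1 `^ (- s))%:E * hausdorff_content s (digit_box lo hi n.+1))%E.
Proof.
move=> s0 lo0 hi0.
set N := Num.truncn (hi n.+1).
pose F (i : nat) := if lo n.+1 <= i.+1%:R then
  [set y : R | digit_box lo hi n.+1 (- i.+1%:R * y + 1)] else set0.
have sub : digit_box lo hi n `<=` \big[setU/set0]_(i < N) F i.
  move=> y /(digit_box_head _ _ _ _ lo0)[d [/andP[lod dhi] _ By]].
  have dN : (d < N)%N by rewrite truncn_ge_nat.
  by rewrite -bigcup_mkord; exists d => //; rewrite /F lod.
apply: (le_trans (le_outer_measure (hausdorff_content s) _ _ sub)).
apply: (le_trans (outer_measure_subadditive (hausdorff_content s) F N)).
set c := hausdorff_content s (digit_box lo hi n.+1).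
have c0 : (0 <= c)%E by exact: outer_measure_ge0.
apply: (@le_trans _ _ (\sum_(i < N) (lo n.+1 `^ (- s))%:E * c)%E).
  apply: lee_sum => i _; rewrite /F; case: ifPn => lod; last first.
    by rewrite outer_measure0 mule_ge0// lee_fin powR_ge0.
  apply: (le_trans (content_affine _ _ _ _ s0 _)).
    by rewrite oppr_eq0 pnatr_eq0.
  rewrite lee_wpmul2r// lee_fin normrN ger0_norm// -mulN1r !powRrM.
  rewrite (powR_inv1 (ltW lo0)) powR_inv1//.
  by rewrite ge0_ler_powR ?nnegrE ?invr_ge0 ?(ltW lo0)// lef_pV2 ?posrE.
rewrite -ge0_sume_distrl => [|i _]; last by rewrite lee_fin powR_ge0.
rewrite lee_wpmul2r// sumEFin lee_fin sumr_const card_ord -mulr_natl.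
by rewrite ler_wpM2r ?powR_ge0// truncn_le.
Qed.

Lemma content_digit_box s lo hi n j : 0 <= s -> (forall k, 0 < lo k.+1) ->
  (forall k, 0 <= hi k.+1) ->
  (hausdorff_content s (digit_box lo hi n) <=
   ((\prod_(i < j) (hi (n + i).+1 * lo (n + i).+1 `^ (- s))) *
    lo (n + j).+1 `^ (- s))%:E)%E.
Proof.
move=> s0 lo0 hi0; elim: j n => [|j IH] n.
  by rewrite big_ord0 mul1r addn0 content_digit_box_start.
apply: (le_trans (content_digit_box_step _ _ _ _ s0 (lo0 n) (hi0 n))).
rewrite big_ord_recl addn0 -mulrA [leRHS]EFinM lee_wpmul2l//.
  by rewrite lee_fin mulr_ge0 ?powR_ge0.
apply: (le_trans (IH n.+1)); rewrite addSnnS.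
by under [in leRHS]eq_bigr => i _ do rewrite lift0 -addSnnS.
Qed.

(** The map has countably many branches, all of them affine. *)
Lemma content0_pierce_map_preimage s (A : set R) : 0 <= s ->
  hausdorff_content s A = 0%E ->
  hausdorff_content s [set x | 0 < x <= 1 /\ A (pierce_map x)] = 0%E.
Proof.
move=> s0 A0; apply/eqP; rewrite eq_le outer_measure_ge0 andbT.
rewrite -(content_bigcup0 s (fun d => [set x : R | A (- d.+1%:R * x + 1)])).
  apply: le_outer_measure => x [x01 Ax].
  have [d [xd _]] := pierce_digit1_gt0 _ x01; exists d => //=.
  by move: Ax; rewrite /pierce_map xd -pmulrn addrC mulNr.
move=> d; apply/eqP; rewrite eq_le outer_measure_ge0 andbT.
apply: (le_trans (content_affine _ _ _ _ s0 _)).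
  by rewrite oppr_eq0 pnatr_eq0.
by rewrite A0 mule0.
Qed.

Lemma content0_iter_pierce_map_preimage s (A : set R) n : 0 <= s ->
  hausdorff_content s A = 0%E ->
  hausdorff_content s [set x | [/\ 0 < x <= 1, irrational x &
                                A (iter n pierce_map x)]] = 0%E.
Proof.
move=> s0 A0; elim: n => [|n IH].
  apply/eqP; rewrite eq_le outer_measure_ge0 andbT -[leRHS]A0.
  by apply: le_outer_measure => x [].
apply/eqP; rewrite eq_le outer_measure_ge0 andbT.
rewrite -(content0_pierce_map_preimage s _ s0 IH).
apply: le_outer_measure => x [x01 irrx]; rewrite iterSr => Ax.
by split => //; have [? ?] := irrational_pierce_map _ x01 irrx.
Qed.


End upper_bound.

(** * Growth of the partial sums of phi *)

Section growth.
Context {R : realType} (phi : nat -> R).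
Hypothesis phi_gt0 : forall n : nat, (1 <= n)%N -> 0 < phi n.
Hypothesis phi_gap : phi n.+1 - phi n @[n --> \oo] --> +oo.

Definition phi_sum n : R := \sum_(1 <= k < n.+1) phi k.

Lemma phi_sumS n : phi_sum n.+1 = phi_sum n + phi n.+1.
Proof. by rewrite /phi_sum big_nat_recr. Qed.

Lemma phi_sum_ge0 n : 0 <= phi_sum n.
Proof. by rewrite /phi_sum big_nat sumr_ge0// => i /andP[i1 _]; exact/ltW/phi_gt0. Qed.

Lemma phi_sum_gt0 n : 0 < phi_sum n.+1.
Proof. by rewrite phi_sumS ltr_wpDl ?phi_sum_ge0// phi_gt0. Qed.

Lemma phi_le_sum n : (0 < n)%N -> phi n <= phi_sum n.
Proof. by case: n => // n _; rewrite phi_sumS lerDr phi_sum_ge0. Qed.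

Lemma phi_gap_ge (c : R) : exists N, forall n, (N <= n)%N -> phi n + c <= phi n.+1.
Proof.
have /cvgryPge/(_ c)[N _ HN] := phi_gap.
by exists N => n Nn; rewrite -lerBrDl; exact: (HN n).
Qed.

(** Increments tending to infinity eventually exceed 2 c; after as many further steps as
    have been made before, half of the slope remains. *)
Lemma phi_superlinear (c : R) : exists N, forall n, (N <= n)%N -> c * n%:R <= phi n.
Proof.
wlog c0 : c / 0 <= c => [H|].
  have [N HN] := H `|c| (normr_ge0 c); exists N => n Nn.
  by apply: le_trans (HN n Nn); rewrite ler_wpM2r// ler_norm.
have [N HN] := phi_gap_ge (2 * c); pose n0 := N.+1.
have H j : 2 * c * j%:R <= phi (n0 + j).
  elim: j => [|j IH]; first by rewrite mulr0 addn0 ltW// phi_gt0.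
  rewrite addnS; apply: le_trans (HN _ _); last by rewrite /n0; lia.
  by rewrite -natr1; lra.
exists (n0 + n0)%N => n nn; have -> : n = (n0 + (n - n0))%N by lia.
apply: le_trans (H _); rewrite [2 * c]mulrC -mulrA ler_wpM2l// -natrM ler_nat.
lia.
Qed.

Lemma phi_sum_superlinear (c : R) :
  exists N, forall n, (N <= n)%N -> c * n%:R <= phi_sum n.
Proof.
have [N HN] := phi_superlinear c; exists N.+1 => n nN.
by apply: le_trans (HN n _) _; [lia|rewrite phi_le_sum//; lia].
Qed.

Lemma sum_phi_shift n j :
  \sum_(i < j) phi (n + i).+1 = phi_sum (n + j) - phi_sum n.
Proof.
elim: j => [|j IH]; first by rewrite big_ord0 addn0 subrr.
by rewrite big_ord_recr/= IH addnS phi_sumS addrAC.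
Qed.

End growth.

(** * The upper bound *)

Section upper.
Context {R : realType} (phi : nat -> R).
Hypothesis phi_gt0 : forall n : nat, (1 <= n)%N -> 0 < phi n.
Hypothesis phi_gap : phi n.+1 - phi n @[n --> \oo] --> +oo.

Let S := phi_sum phi.
Let lo (e : R) k := expR ((1 - e) * phi k).
Let hi (e : R) k := expR ((1 + e) * phi k).

Lemma pierce_E_digit_box (e : R) : 0 < e ->
  pierce_E phi `<=` \bigcup_N [set x | [/\ 0 < x <= 1, irrational x &
    digit_box (lo e) (hi e) N (iter N pierce_map x)]].
Proof.
move=> e0 x [x01 [irrx /cvgrPdist_le/(_ e e0)[N _ HN]]].
exists N => //; split => //.
have [y01 irry] := irrational_iter_pierce_map N _ x01 irrx; split => // i.
have -> : pierce_digit i.+1 (iter N pierce_map x) = pierce_digit (N + i).+1 x.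
  by rewrite /pierce_digit/= addnC iterD.
have [z01 _] := irrational_iter_pierce_map (N + i) _ x01 irrx.
have [d [xd _]] := pierce_digit1_gt0 _ z01.
have := HN (N + i).+1 (leq_trans (leq_addr _ _) (leqnSn _)).
rewrite /= /pierce_digit/= xd -pmulrn /lo /hi.
have p0 : 0 < phi (N + i).+1 by exact: phi_gt0.
rewrite ler_norml => /andP[H1 H2].
rewrite -[d.+1%:R]lnK ?posrE// !ler_expR -[X in _ && X]ler_pdivrMr// -[X in X && _]ler_pdivlMr//.
by apply/andP; split; lra.
Qed.

Lemma content_digit_box_expR s e n j : 0 <= s ->
  (hausdorff_content s (digit_box (lo e) (hi e) n) <=
   (expR ((1 + e) * (S (n + j) - S n)
         - s * (1 - e) * (S (n + j).+1 - S n)))%:E)%E.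
Proof.
move=> s0; apply: (le_trans (content_digit_box _ (lo e) (hi e) n j s0 _ _)).
- by move=> k; exact: expR_gt0.
- by move=> k; exact: expR_ge0.
rewrite lee_fin /lo /hi.
under eq_bigr => i _ do rewrite -expRM -expRD.
rewrite -expR_sum -expRM -expRD ler_expR.
rewrite (eq_bigr (fun i : 'I_j =>
  ((1 + e) - s * (1 - e)) * phi (n + i).+1)) => [|i _]; last by ring.
rewrite -mulr_sumr sum_phi_shift /S phi_sumS.
by rewrite le_eqVlt; apply/orP; left; apply/eqP; ring.
Qed.

(** The exponent of the preceding bound is at most a constant minus a positive
    multiple of S m, for the infinitely many m with rho * S m <= S m.+1. *)
Lemma content_digit_box0 s rho e n : 0 <= s ->
  (forall N, exists2 m, (N <= m)%N & rho * S m <= S m.+1) ->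
  0 <= e < 1 -> 1 + e < s * (1 - e) * rho ->
  hausdorff_content s (digit_box (lo e) (hi e) n) = 0%E.
Proof.
move=> s0 freq /andP[e0 e1] erho.
apply/eqP; rewrite eq_le outer_measure_ge0 andbT; apply/lee_addgt0Pr => t t0.
rewrite add0e.
set k := s * (1 - e) * rho - (1 + e).
have k0 : 0 < k by rewrite subr_gt0.
have se : 0 <= s * (1 - e) by rewrite mulr_ge0// subr_ge0 ltW.
set c := (s * (1 - e) - (1 + e)) * S n.
have [N HN] := phi_sum_superlinear _ phi_gt0 phi_gap 1.
(* The bound falls below t as soon as S m >= B. *)
pose B := (c - ln t) / k.
have [m] := freq (maxn (maxn N n) (Num.truncn `|B|).+1).
rewrite !geq_max => /andP[/andP[Nm nm] Bm] rhom.
have Sm : B <= S m.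
  apply: le_trans (HN m Nm); rewrite mul1r (le_trans (ler_norm _))//.
  by apply/ltW/(lt_le_trans (truncnS_gt _)); rewrite ler_nat.
apply: (le_trans (content_digit_box_expR s e n (m - n) s0)).
rewrite subnKC// lee_fin -[leRHS]lnK ?posrE// ler_expR.
have H1 : s * (1 - e) * (rho * S m) <= s * (1 - e) * S m.+1 by rewrite ler_wpM2l.
have H2 : c - ln t <= S m * k by rewrite -ler_pdivrMr.
move: H2; rewrite /c /k.
nra.
Qed.

Lemma content_pierce_E0 s rho : 0 < s -> 1 < s * rho ->
  (forall N, exists2 m, (N <= m)%N & rho * S m <= S m.+1) ->
  hausdorff_content s (pierce_E phi) = 0%E.
Proof.
move=> s0 srho freq.
(* 1 + e < s (1 - e) rho holds iff e < (s rho - 1) / (s rho + 1). *)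
pose e := (s * rho - 1) / (s * rho + 1) / 2.
have p0 : 0 < s * rho + 1 by lra.
have e0 : 0 < e by rewrite !divr_gt0// subr_gt0.
have eE : e * (s * rho + 1) = (s * rho - 1) / 2 by rewrite /e; field; lra.
have e1 : e < 1 by rewrite /e ltr_pdivrMr// ltr_pdivrMr//; lra.
apply/eqP; rewrite eq_le outer_measure_ge0 andbT.
apply: (le_trans (le_outer_measure (hausdorff_content s) _ _
                    (pierce_E_digit_box _ e0))).
rewrite [leLHS]content_bigcup0// => N; apply: content0_iter_pierce_map_preimage.
  exact: ltW.
apply: (content_digit_box0 s rho) => //; first exact: ltW.
  by rewrite ltW.
lra.
Qed.

End upper.

(** * Points with a given digit sequence *)

Section coding.
Context {R : realType}.
Implicit Types (d : nat -> nat) (m n k : nat).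

Definition dshift d : nat -> nat := fun i => d i.+1.

(** The m-th partial sum of the Pierce expansion 1/d_0 - 1/(d_0 d_1) + ...,
    written as a nesting of inverse branches so that inductions follow the
    shift of the digit sequence. *)
Fixpoint pierce_partial m d : R :=
  if m is m'.+1 then (1 - pierce_partial m' (dshift d)) / (d 0%N)%:R else 0.

Definition pierce_point d : R := limn (pierce_partial ^~ d).

(** The bound 2 on the first digit makes every inverse branch a contraction by
    1/2. *)
Definition pierce_code d := (2 <= d 0)%N /\ forall i, (d i < d i.+1)%N.

Lemma pierce_code_ge2 d : pierce_code d -> forall i, (2 <= d i)%N.
Proof. by move=> [d0 dS]; elim=> // i IH; rewrite ltnW// (leq_ltn_trans IH). Qed.

Lemma pierce_code_dshift d : pierce_code d -> pierce_code (dshift d).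
Proof. by move=> dc; split=> [|i]; [exact: (pierce_code_ge2 _ dc 1%N)|exact: dc.2]. Qed.

Lemma pierce_partialS m d :
  pierce_partial m.+1 d = (1 - pierce_partial m (dshift d)) / (d 0%N)%:R.
Proof. by []. Qed.

Lemma pierce_partial_itv m d : (forall i, 2 <= d i)%N ->
  0 <= pierce_partial m d <= 1.
Proof.
elim: m d => [|m IH] d d2 /=; first by rewrite lexx ler01.
have /andP[p0 p1] := IH (dshift d) (fun i => d2 i.+1).
have d1 : 2 <= (d 0%N)%:R :> R by rewrite ler_nat.
by rewrite divr_ge0 ?subr_ge0//= ler_pdivrMr; lra.
Qed.

Lemma pierce_partial_dist m d : (forall i, 2 <= d i)%N ->
  `|pierce_partial m.+1 d - pierce_partial m d| <= 2^-1 ^+ m.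
Proof.
elim: m d => [|m IH] d d2.
  rewrite subr0 expr0; have /andP[p0 p1] := pierce_partial_itv 1 _ d2.
  by rewrite ger0_norm.
have := IH (dshift d) (fun i => d2 i.+1).
rewrite (pierce_partialS m.+1 d) (pierce_partialS m d).
set x := pierce_partial m.+1 (dshift d); set y := pierce_partial m (dshift d).
move=> xy; have d1 : 2 <= (d 0%N)%:R :> R by rewrite ler_nat.
have -> : (1 - x) / (d 0%N)%:R - (1 - y) / (d 0%N)%:R = (y - x) / (d 0%N)%:R.
  by ring.
rewrite normrM distrC [`|_^-1|]ger0_norm ?invr_ge0// exprSr.
by rewrite ler_pM// lef_pV2 ?posrE//; lra.
Qed.

Lemma cvg_pierce_partial d : (forall i, 2 <= d i)%N ->
  cvgn (pierce_partial ^~ d).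
Proof.
move=> d2; have -> : pierce_partial ^~ d =
    series (fun m => pierce_partial m.+1 d - pierce_partial m d).
  apply/funext => m; rewrite seriesEnat/= telescope_sumr//=.
  by rewrite subr0.
apply: normed_cvg; apply: (@series_le_cvg _ _ (geometric 1 2^-1)) => [m|m|m|].
- exact: normr_ge0.
- by rewrite /geometric/= mul1r exprn_ge0.
- by rewrite /geometric/= mul1r; exact: pierce_partial_dist.
- by apply: is_cvg_geometric_series; rewrite ger0_norm//; lra.
Qed.

Lemma pierce_pointS d : (forall i, 2 <= d i)%N ->
  pierce_point d = (1 - pierce_point (dshift d)) / (d 0%N)%:R.
Proof.
move=> d2; apply: cvg_lim => //.
rewrite -cvg_shiftS /=.
apply: cvgMl; apply: cvgB; first exact: cvg_cst.
by apply: cvg_pierce_partial => i; exact: d2.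
Qed.

Lemma pierce_point_itv d : (forall i, 2 <= d i)%N -> 0 < pierce_point d < 1.
Proof.
have H e : (forall i, 2 <= e i)%N -> 0 <= pierce_point e <= 1.
  move=> e2; apply/andP; split.
    apply: limr_ge; first exact: cvg_pierce_partial.
    by apply: nearW => m; have /andP[] := pierce_partial_itv m _ e2.
  apply: limr_le; first exact: cvg_pierce_partial.
  by apply: nearW => m; have /andP[] := pierce_partial_itv m _ e2.
have H1 e : (forall i, 2 <= e i)%N -> 0 <= pierce_point e <= 2^-1.
  move=> e2; have /andP[-> _] := H _ e2.
  rewrite pierce_pointS//= ler_pdivrMr ?ltr0n ?(ltn_trans _ (e2 0%N))//.
  have /andP[h _] := H _ (fun i => e2 i.+1).
  have : 2 <= (e 0%N)%:R :> R by rewrite ler_nat.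
  lra.
move=> d2; have /andP[_ h1] := H1 _ d2; rewrite (le_lt_trans h1) ?andbT; last by lra.
have /andP[_ h2] := H1 _ (fun i => d2 i.+1).
rewrite pierce_pointS// divr_gt0 ?ltr0n ?(ltn_trans _ (d2 0%N))//.
move: h2; rewrite -/(dshift d); lra.
Qed.

Lemma pierce_point_lt d : (forall i, 2 <= d i)%N ->
  pierce_point d < (d 0%N)%:R^-1.
Proof.
move=> d2; have /andP[h _] := pierce_point_itv _ (fun i => d2 i.+1).
rewrite pierce_pointS// -[ltRHS]mul1r ltr_pM2r ?invr_gt0 ?ltr0n.
  by move: h; rewrite -/(dshift d); lra.
by rewrite (ltn_trans _ (d2 0%N)).
Qed.

(** The point of the shifted sequence is below 1 / d_1 <= 1 / (d_0 + 1), which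
    puts the point itself in the interval where the first digit is d_0; here
    strict monotonicity of the digits is essential. *)
Lemma pierce_point_digit1 d : pierce_code d ->
  pierce_digit1 (pierce_point d) = d 0%N /\
  pierce_map (pierce_point d) = pierce_point (dshift d) /\
  pierce_point (dshift d) < pierce_point d.
Proof.
move=> dc; have d2 := pierce_code_ge2 _ dc.
have := pierce_point_lt _ (pierce_code_ge2 _ (pierce_code_dshift _ dc)).
have := pierce_pointS _ d2.
have /andP[] := pierce_point_itv _ d2.
have /andP[] := pierce_point_itv _ (pierce_code_ge2 _ (pierce_code_dshift _ dc)).
set x := pierce_point d; set y := pierce_point (dshift d) => y0 _ x0 _ xy ylt.
have d0 : 2 <= (d 0%N)%:R :> R by rewrite ler_nat.
have dx : (d 0%N)%:R * x = 1 - y by rewrite xy mulrC divfK//; lra.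
have dd : (d 0%N).+1%:R <= (d 1%N)%:R :> R by rewrite ler_nat; exact: dc.2.
have yd : (d 0%N).+1%:R * y < 1.
  have : (d 1%N)%:R * y < 1.
    by rewrite mulrC -ltr_pdivlMr ?mul1r//; rewrite (lt_le_trans _ dd).
  by apply: le_lt_trans; rewrite ler_pM2r.
move: yd; rewrite -natr1 mulrDl mul1r => yd.
have key : 1 < (d 0%N)%:R * x + x.
  rewrite -(@ltr_pM2l _ (d 0%N)%:R); last by lra.
  by rewrite mulrDr dx; nra.
have digE : pierce_digit1 x = d 0%N.
  apply: pierce_digit1_eq => //; rewrite -natr1 mulrDl mul1r key andbT dx; lra.
split=> //; split; first by rewrite /pierce_map digE -pmulrn dx; ring.
by move: key; rewrite dx; lra.
Qed.

Lemma iter_pierce_map_point d n : pierce_code d ->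
  pierce_code (fun i => d (n + i)%N) /\
  iter n pierce_map (pierce_point d) = pierce_point (fun i => d (n + i)%N).
Proof.
move=> dc; elim: n => [//|n [IHc IHn]]; split.
  by have := pierce_code_dshift _ IHc; rewrite /dshift; under [fun i => _]eq_fun do rewrite addnS.
rewrite iterS IHn (pierce_point_digit1 _ IHc).2.1 /dshift.
by congr pierce_point; apply/funext => i; rewrite addnS.
Qed.

Lemma pierce_digit_point d k : pierce_code d ->
  pierce_digit k.+1 (pierce_point d) = d k.
Proof.
move=> dc; rewrite /pierce_digit/=.
have [kc ->] := iter_pierce_map_point d k dc.
by rewrite (pierce_point_digit1 _ kc).1 addn0.
Qed.

(** On a rational a / b the map keeps the denominator and strictly decreases
    the numerator, so an infinite expansion would be an infinite descent. *)
Lemma irrational_pierce_point d : pierce_code d -> irrational (pierce_point d).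
Proof.
move=> dc /rationalP[a [b ab]].
have [b0|b0] := posnP b.
  have /andP[] := pierce_point_itv _ (pierce_code_ge2 _ dc).
  by rewrite ab b0 invr0 mulr0 ltxx.
have bR : 0 < b%:R :> R by rewrite ltr0n.
have [m am] : exists m : nat, a = m.
  have /andP[+ _] := pierce_point_itv _ (pierce_code_ge2 _ dc).
  by rewrite ab pmulr_lgt0 ?invr_gt0// ltr0z; case: a {ab} => // m _; exists m.
move: ab; rewrite am -pmulrn => {a am}.
elim/ltn_ind: m d dc => m IH d dc dm.
have [_ [Td Tlt]] := pierce_point_digit1 _ dc.
have /andP[T0 _] := pierce_point_itv _ (pierce_code_ge2 _ (pierce_code_dshift _ dc)).
have dg := (pierce_point_digit1 _ dc).1.
have TE : pierce_point (dshift d) = (b%:R - (d 0%N * m)%:R) / b%:R.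
  by rewrite -Td /pierce_map dg dm -pmulrn natrM; field; lra.
have dmb : (d 0 * m < b)%N.
  by move: T0; rewrite TE pmulr_lgt0 ?invr_gt0// subr_gt0 ltr_nat.
apply: (IH (b - d 0 * m)%N _ _ (pierce_code_dshift _ dc)); last first.
  by rewrite TE natrB// ltnW.
by move: Tlt; rewrite TE dm ltr_pM2r ?invr_gt0// -(natrB _ (ltnW dmb)) ltr_nat.
Qed.

End coding.

(** * Uniform mass on a digit Cantor set *)

Section mass.
Context {R : realType} (a : nat -> nat).
Implicit Types (d : nat -> nat) (n j k t : nat) (U : set R).
Hypothesis a_ge2 : forall k, (2 <= a k)%N.
Hypothesis a_growth : forall k, (4 * a k <= a k.+1)%N.

(** Digit sequences of the n-th shifted Cantor set; the i-th digit ranges over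
    the a (n + i) integers starting at a (n + i). *)
Definition window n : set (nat -> nat) :=
  [set d | forall i, (a (n + i) <= d i < 2 * a (n + i))%N].

Definition branch n t : R -> R := fun y => (1 - y) / (a n + t)%:R.

Definition dcons c d : nat -> nat := fun i => if i is i'.+1 then d i' else c.

Lemma window_code n d : window n d -> pierce_code d.
Proof.
move=> dn; split; first by have := dn 0%N; have := a_ge2 (n + 0); lia.
move=> i; have := dn i; have := dn i.+1; have := a_growth (n + i).
have := a_ge2 (n + i); rewrite addnS; lia.
Qed.

Lemma window_ge2 n d : window n d -> forall i, (2 <= d i)%N.
Proof. by move=> /window_code/pierce_code_ge2. Qed.

Lemma window_dcons n t d : (t < a n)%N -> window n.+1 d ->
  window n (dcons (a n + t) d).
Proof.
move=> tn dn [|i] /=; first by rewrite addn0; lia.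
by have := dn i; rewrite addSnnS.
Qed.

Lemma pierce_point_dcons n t d : (t < a n)%N -> window n.+1 d ->
  pierce_point (dcons (a n + t) d) = branch n t (pierce_point d) :> R.
Proof. by move=> tn /(window_dcons _ _ _ tn)/window_ge2/pierce_pointS ->. Qed.

Definition hits n U := `[< exists d, window n d /\ U (pierce_point d) >].

(** The proportion, among the words of length j admissible from level n on, of
    those whose cylinder in the Cantor set meets U. For increasing j it
    decreases to the uniform mass of U when U is compact. *)
Fixpoint mass n j U : R :=
  if j is j'.+1 then
    (\sum_(t < a n) mass n.+1 j' (branch n t @^-1` U)) / (a n)%:R
  else (hits n U)%:R.

Lemma window_size_gt0 n : 0 < (a n)%:R :> R.
Proof. by rewrite ltr0n (leq_trans _ (a_ge2 n)). Qed.

Lemma mass_ge0 n j U : 0 <= mass n j U.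
Proof.
elim: j n U => [|j IH] n U; first by rewrite /= ler0n.
by rewrite /= divr_ge0// sumr_ge0.
Qed.

Lemma mass_le1 n j U : mass n j U <= 1.
Proof.
elim: j n U => [|j IH] n U; first by rewrite /= lern1 leq_b1.
rewrite /= ler_pdivrMr ?window_size_gt0// mul1r.
rewrite (le_trans (ler_sum _ (fun (t : 'I_(a n)) _ => IH n.+1 _)))//.
by rewrite sumr_const card_ord.
Qed.

Lemma hits_branch n t U : (t < a n)%N -> hits n.+1 (branch n t @^-1` U) ->
  hits n U.
Proof.
move=> tn /asboolP[d [dn Ud]]; apply/asboolP; exists (dcons (a n + t) d).
by split; [exact: window_dcons|rewrite (pierce_point_dcons n)].
Qed.

Lemma mass_eq0 n j U : ~~ hits n U -> mass n j U = 0.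
Proof.
elim: j n U => [|j IH] n U nU; first by rewrite /= (negbTE nU).
rewrite /= big1 ?mul0r// => t _; rewrite IH//.
by apply: contra nU; exact: hits_branch.
Qed.

(** Averaging over the first digit does not increase the total. With the depth
    j lowered to [j.-1] this also covers depth 0, where it says that a branch
    can only meet U if the whole set does. *)
Lemma sum_mass_branch n j U :
  \sum_(t < a n) mass n.+1 j.-1 (branch n t @^-1` U) <= (a n)%:R * mass n j U.
Proof.
case: j => [|j] /=; last by rewrite mulrC divfK ?gt_eqF ?window_size_gt0.
case: (boolP (hits n U)) => nU; last first.
  rewrite big1 ?mulr0// => t _; rewrite [hits _ _](negbTE _)//.
  by apply: contra nU; exact: hits_branch.
rewrite mulr1; apply: (@le_trans _ _ (\sum_(t < a n) 1)).
  by apply: ler_sum => t _; rewrite lern1 leq_b1.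
by rewrite sumr_const card_ord.
Qed.

(** The totals of the branches average to at most the total of the whole, so
    one of them is below 1. *)
Lemma small_mass_branch n (J : nat -> nat) (V : nat -> set R) :
  (\sum_(0 <= i <oo) (mass n (J i) (V i))%:E < 1)%E ->
  exists t, (t < a n)%N /\
    (\sum_(0 <= i <oo) (mass n.+1 (J i).-1 (branch n t @^-1` V i))%:E < 1)%E.
Proof.
move=> V1; apply: contrapT => /forallNP H.
have H1 (t : 'I_(a n)) : (1 <= \sum_(0 <= i <oo)
    (mass n.+1 (J i).-1 (branch n t @^-1` V i))%:E)%E.
  by rewrite leNgt; apply/negP => t1; apply: (H t).
have : ((a n)%:R%:E <= \sum_(t < a n) \sum_(0 <= i <oo)
    (mass n.+1 (J i).-1 (branch n t @^-1` V i))%:E)%E.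
  apply: (@le_trans _ _ (\sum_(t < a n) 1%:E)%E).
    by rewrite sumEFin sumr_const card_ord.
  by apply: lee_sum => t _; exact: H1.
rewrite -nneseries_sum => [|t i _]; last by rewrite lee_fin mass_ge0.
apply/negP; rewrite -ltNge.
apply: (@le_lt_trans _ _ ((a n)%:R%:E * \sum_(0 <= i <oo) (mass n (J i) (V i))%:E)%E).
  rewrite -nneseriesZl => [|i _]; last by rewrite lee_fin mass_ge0.
  apply: lee_nneseries => [i _ _|i _].
    by apply: sume_ge0 => t _; rewrite lee_fin mass_ge0.
  by rewrite sumEFin lee_fin sum_mass_branch.
rewrite -[ltRHS]mule1 lte_pmul2l//; first by rewrite lte_fin window_size_gt0.
Qed.

(** Repeated choice of a branch of total mass below 1 produces a digit
    sequence. Once the depth of the i-th set has been used up, its term is 0 or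
    1, hence 0: the cylinder reached by then does not meet the i-th set. *)
Lemma escape_small_mass n (J : nat -> nat) (V : nat -> set R) :
  (\sum_(0 <= i <oo) (mass n (J i) (V i))%:E < 1)%E ->
  exists2 d, window n d & forall i, ~ V i (pierce_point d).
Proof.
move=> V1.
pose small n (S : (nat -> nat) * (nat -> set R)) :=
  (\sum_(0 <= i <oo) (mass n (S.1 i) (S.2 i))%:E < 1)%E.
pose next n t (S : (nat -> nat) * (nat -> set R)) :=
  (fun i => (S.1 i).-1, fun i => branch n t @^-1` S.2 i).
have [f fP] : {f : nat -> (nat -> nat) * (nat -> set R) -> nat &
    forall m S, small m S -> (f m S < a m)%N /\ small m.+1 (next m (f m S) S)}.
  suff /choice[f fP] : forall mS, exists t, small mS.1 mS.2 ->
      (t < a mS.1)%N /\ small mS.1.+1 (next mS.1 t mS.2).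
    by exists (fun m S => f (m, S)) => m S; exact: (fP (m, S)).
  move=> [m S] /=; case: (pselect (small m S)) => [/small_mass_branch[t tP]|nS].
    by exists t.
  by exists 0%N.
(* The state after k choices: remaining depths, and the sets seen from the
   current cylinder through the chosen inverse branches. *)
pose St := fix St k := if k is k'.+1
  then next (n + k')%N (f (n + k')%N (St k')) (St k') else (J, V).
pose d k := (a (n + k) + f (n + k)%N (St k))%N.
have smallSt k : small (n + k)%N (St k).
  elim: k => [|k IH]; first by rewrite addn0.
  by have [_] := fP _ _ IH; rewrite addnS.
have dn k : window (n + k) (fun i => d (k + i)%N).
  by move=> i; have [] := fP _ _ (smallSt (k + i)%N); rewrite /d addnA; lia.
exists d; first by have := dn 0%N; rewrite addn0.
move=> i Vi.
have StJ k : (St k).1 i = (J i - k)%N.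
  by elim: k => [|k IH] /=; [rewrite subn0|rewrite IH subnS].
have StV k : (St k).2 i (pierce_point (fun l => d (k + l)%N)).
  elim: k => [//|k IH]; rewrite /= /preimage/=.
  suff -> : branch (n + k) (f (n + k)%N (St k)) (pierce_point (fun l => d (k.+1 + l)%N))
    = pierce_point (fun l => d (k + l)%N) by [].
  rewrite [RHS]pierce_pointS; last by apply: (window_ge2 (n + k)); exact: dn.
  rewrite /branch /d addn0; congr ((1 - pierce_point _) / _).
  by apply/funext => l; rewrite /dshift addSnnS.
have := smallSt (J i); rewrite /small ltNge => /negP; apply.
rewrite (@nneseriesD1 _ _ i xpredT)//; last by move=> k _; rewrite lee_fin mass_ge0.
rewrite StJ subnn /=; apply: (@le_trans _ _ 1%E) => //.
have -> : hits (n + J i) ((St (J i)).2 i).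
  by apply/asboolP; eexists; split; [exact: (dn (J i))|exact: StV].
by rewrite leeDl// nneseries_ge0// => k _ _; rewrite lee_fin mass_ge0.
Qed.

End mass.

(** * The mass distribution principle *)

Section frostman.
Context {R : realType} (a : nat -> nat) (s : R) (C : nat -> R).
Implicit Types (n j k t : nat) (U : set R) (r : R).
Hypothesis a_ge2 : forall k, (2 <= a k)%N.
Hypothesis a_growth : forall k, (4 * a k <= a k.+1)%N.
Hypothesis s_ge0 : 0 <= s.
Hypothesis s_le1 : s <= 1.
Hypothesis C_ge : forall n, (16 * (a n)%:R) `^ s <= C n.
Hypothesis C_step : forall n, C n.+1 * (2 * (a n)%:R) `^ s <= C n * (a n)%:R.

Lemma bound_ge1 n : 1 <= C n.
Proof.
apply: le_trans (C_ge n); rewrite -[leLHS](powRr0 (16 * (a n)%:R)); apply: ler_powR => //.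
have : 2 <= (a n)%:R :> R by rewrite ler_nat.
lra.
Qed.

(** A point in branch t has first digit a n + t and remaining part below
    1 / (4 a n). So the branch with first digit d lies just below 1 / d, within
    half of the distance to the next reciprocal 1 / (d + 1). *)
Lemma branch_gap n t t' (d d' : nat -> nat) : (t < t')%N -> (t' < a n)%N ->
  window a n.+1 d -> window a n.+1 d' ->
  (t' - t)%:R <= 8 * (a n)%:R ^+ 2 *
    `|branch a n t (pierce_point d) - branch a n t' (pierce_point d')| :> R.
Proof.
move=> tt' t'n dn dn'.
have d2 := window_ge2 _ a_ge2 a_growth _ _ dn.
have d2' := window_ge2 _ a_ge2 a_growth _ _ dn'.
have /andP[y0 _] := @pierce_point_itv R _ d2.
have /andP[y0' _] := @pierce_point_itv R _ d2'.
have ylt := @pierce_point_lt R _ d2.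
rewrite /branch; move: ylt y0 y0'.
set y := pierce_point d; set y' := pierce_point d' => ylt y0 y0'.
apply: le_trans (ler_wpM2l _ (ler_norm _)); last by rewrite mulr_ge0// exprn_ge0.
set b : R := (a n + t)%:R; set b' : R := (a n + t')%:R; set A : R := (a n)%:R.
have A2 : 2 <= A by rewrite ler_nat.
have bA : A <= b by rewrite ler_nat leq_addr.
have bb' : b + (t' - t)%:R = b' by rewrite -natrD; congr _%:R; lia.
have k1 : 1 <= (t' - t)%:R :> R by rewrite ler1n; lia.
have b'A : b' <= 2 * A by rewrite -natrM ler_nat; lia.
have yA : 4 * A * y < 1.
  have h : 4 * A <= (d 0%N)%:R.
    rewrite -natrM ler_nat (leq_trans (a_growth n))//.
    by have := dn 0%N; rewrite addn0 => /andP[].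
  rewrite mulrC -ltr_pdivlMr ?mul1r; last by lra.
  by rewrite (lt_le_trans ylt)// lef_pV2 ?posrE//; lra.
have -> : (1 - y) / b - (1 - y') / b' = (b' * (1 - y) - b * (1 - y')) / (b * b').
  by field; apply/andP; split; lra.
rewrite mulrA ler_pdivlMr; last by rewrite mulr_gt0//; lra.
set k : R := (t' - t)%:R in bb' k1 *.
have h1 : k / 2 <= b' * (1 - y) - b * (1 - y') by nra.
have h2 : b * b' <= (2 * A) * (2 * A) by nra.
apply: (@le_trans _ _ (k * ((2 * A) * (2 * A)))); first by rewrite ler_wpM2l//; lra.
apply: (@le_trans _ _ (8 * A ^+ 2 * (k / 2))).
  by rewrite le_eqVlt; apply/orP; left; apply/eqP; field.
by rewrite ler_wpM2l// mulr_ge0// exprn_ge0//; lra.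
Qed.

Lemma count_window m t0 K : (\sum_(t < m) (t0 <= t <= t0 + K) <= K.+1)%N.
Proof.
suff : (\sum_(t < m) (t0 <= t <= t0 + K) <= minn (m - t0) K.+1)%N by lia.
elim: m => [|m IH]; first by rewrite big_ord0.
rewrite big_ord_recr /=; set S := (\sum_(i < m) _)%N in IH *.
by case: (boolP (t0 <= m <= t0 + K)%N) => h /=; rewrite ?negb_and in h; lia.
Qed.

(** If U meets at least two branches, the gaps bound the number of branches met
    by 16 (a n)^2 r, and [mass] by min (1, 16 a n r) <= (16 a n r)^s.
    If it meets only one, pull U back along this branch: the diameter is
    multiplied by the digit, at least 2, so that the process ends when the
    diameter exceeds 1; this is what the integer M controls. The hypotheses
    [C_ge] and [C_step] are what the two cases need. *)
Lemma frostman_bound M n U r : 0 < r -> 1 <= r * 2 ^+ M ->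
  (forall x y, U x -> U y -> `|x - y| <= r) ->
  exists j, mass a n j U <= C n * r `^ s.
Proof.
elim: M n U r => [|M IH] n U r r0 rM Ur.
  exists 0%N; apply: le_trans (mass_le1 _ a_ge2 _ _ _) _.
  rewrite -[leLHS]mulr1 ler_pM//; first exact: bound_ge1.
  by rewrite -[leLHS](powRr0 r) ler_powR//; rewrite expr0 mulr1 in rM.
pose P t := (t < a n)%N && hits a n.+1 (branch a n t @^-1` U).
have A2 : 2 <= (a n)%:R :> R by rewrite ler_nat.
have [[t0 Pt0]|nP] := pselect (exists t, P t); last first.
  exists 1%N; rewrite /= big1; last first.
    move=> t _; case: (boolP (hits _ _ _)) => // mt.
    by case: nP; exists t; rewrite /P ltn_ord.
  by rewrite mul0r mulr_ge0 ?powR_ge0// (le_trans _ (bound_ge1 n)).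
have [t Pt tmin] := ex_minnP (ex_intro P t0 Pt0).
have /andP[tn mt] := Pt.
have [[t' [Pt' t't]]|only] := pselect (exists t', P t' /\ t' != t).
- exists 1%N.
  have D t1 : P t1 -> (t < t1)%N -> (t1 - t)%:R <= 8 * (a n)%:R ^+ 2 * r.
    move=> /andP[t1n /asboolP[d1 [dn1 U1]]] tt1.
    have /asboolP[d [dn Ud]] := mt.
    apply: le_trans (branch_gap _ _ _ _ _ tt1 t1n dn dn1) _.
    by rewrite ler_wpM2l ?mulr_ge0 ?exprn_ge0//; exact: Ur.
  set B := 8 * (a n)%:R ^+ 2 * r in D.
  (* A second branch exists, so the + 1 in the count is absorbed by B. *)
  have B1 : 1 <= B.
    have tt' : (t < t')%N by rewrite ltn_neqAle eq_sym t't tmin.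
    by apply: le_trans (D _ Pt' tt'); rewrite ler1n; lia.
  have massB : mass a n 1 U <= 16 * (a n)%:R * r.
    rewrite /= ler_pdivrMr; last by lra.
    apply: (@le_trans _ _ (\sum_(i < a n) (t <= i <= t + Num.truncn B)%N)%:R).
      rewrite natr_sum; apply: ler_sum => i _.
      rewrite ler_nat; case: (boolP (hits _ _ _)) => // mi.
      have Pi : P i by rewrite /P ltn_ord.
      have /orP[/eqP <-|ti] : (t == i) || (t < i)%N by rewrite -leq_eqVlt tmin.
        by rewrite leqnn leq_addr.
      rewrite (ltnW ti) -leq_subLR truncn_ge_nat; last by lra.
      by rewrite D.
    apply: (@le_trans _ _ (Num.truncn B).+1%:R); first by rewrite ler_nat count_window.
    rewrite -natr1; have : (Num.truncn B)%:R <= B by rewrite truncn_le; lra.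
    rewrite /B in B1 *; nra.
  have p0 : 0 < 16 * (a n)%:R * r by rewrite mulr_gt0//; lra.
  apply: (@le_trans _ _ ((16 * (a n)%:R * r) `^ s)); last first.
    by rewrite powRM ?ler_wpM2r ?powR_ge0 ?(ltW r0)//; lra.
  have [h|h] := leP 1 (16 * (a n)%:R * r).
    apply: le_trans (mass_le1 _ a_ge2 _ _ _) _.
    by rewrite -[leLHS](powRr0 (16 * (a n)%:R * r)) ler_powR.
  by apply: (le_trans massB); rewrite ger1_powR// p0 ltW.
- set b : R := (a n + t)%:R.
  have b2 : 2 <= b by rewrite ler_nat (leq_trans (a_ge2 n))// leq_addr.
  have bA : b <= 2 * (a n)%:R by rewrite -natrM ler_nat; lia.
  have [|||j jP] := IH n.+1 (branch a n t @^-1` U) (r * b).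
  + by rewrite mulr_gt0//; lra.
  + apply: (le_trans rM); rewrite exprS mulrA ler_wpM2r ?exprn_ge0//.
    by rewrite ler_wpM2l// ltW.
  + move=> x y /= Ux Uy; have := Ur _ _ Ux Uy; rewrite /branch -/b.
    have -> : (1 - x) / b - (1 - y) / b = (y - x) / b by ring.
    by rewrite normrM [`|b^-1|]ger0_norm ?invr_ge0 ?ler_pdivrMr ?(distrC y)//; lra.
  exists j.+1; rewrite /= ler_pdivrMr; last by lra.
  rewrite (bigD1 (Ordinal tn))//= big1 ?addr0; last first.
    move=> i it; apply: mass_eq0 => //; apply/negP => mi; apply: only.
    by exists i; split; [rewrite /P ltn_ord|].
  apply: (le_trans jP); rewrite powRM; [|lra|lra].
  rewrite [r `^ s * _]mulrC mulrA [leRHS]mulrAC ler_wpM2r ?powR_ge0//.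
  apply: le_trans (C_step n); rewrite ler_wpM2l ?(le_trans _ (bound_ge1 n.+1))//.
  by rewrite ge0_ler_powR// ?nnegrE; lra.
Qed.

(** The error e is needed for sets of diameter 0, to which [frostman_bound] is
    applied with a small positive r instead of the diameter. *)
Lemma mass_le_diam_pow n U (e : R) : 0 < e ->
  exists j, ((mass a n j U)%:E <= (C n)%:E * (diam_pow s U + e%:E))%E.
Proof.
move=> e0; have C0 : 0 <= C n := le_trans ler01 (bound_ge1 n).
have [->|/set0P U0] := eqVneq U set0.
  exists 0%N; rewrite mass_eq0//; last by apply/negP => /asboolP[d [_ []]].
  by rewrite mule_ge0 ?lee_fin// adde_ge0 ?diam_pow_ge0// lee_fin ltW.
rewrite diam_powE//; have := diam_ge0 _ U0.
case dU : (diam U) => [r| |]//; last first.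
  move=> _; exists 0%N; apply: (@le_trans _ _ 1%E); first by rewrite lee_fin mass_le1.
  have y1 : (1 <= +oo `^ s :> \bar R)%E.
    by have [->|s0] := eqVneq s 0; [rewrite poweRe0|rewrite poweRyr// leey].
  rewrite -[leLHS]mule1; apply: lee_pmul => //; first by rewrite lee_fin bound_ge1.
  by rewrite -[leLHS]adde0 leeD// lee_fin ltW.
rewrite lee_fin => r0; have dUr : (diam U <= r%:E)%E by rewrite dU.
suff [q q0 [rq qe]] : exists2 q : R, 0 < q & r <= q /\ q `^ s <= r `^ s + e.
  have [M qM] : exists M, 1 <= q * 2 ^+ M.
    exists (Num.truncn q^-1).+1; rewrite -ler_pdivrMl// mulr1.
    apply/ltW/(lt_le_trans (truncnS_gt _)).
    by rewrite -natrX ler_nat ltnW// ltn_expl.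
  have [j jP] := frostman_bound M n U q q0 qM (fun x y Ux Uy =>
    le_trans ((diam_leP U r).1 dUr x y Ux Uy) rq).
  exists j; rewrite poweR_EFin -EFinD -EFinM lee_fin (le_trans jP)//.
  by rewrite ler_wpM2l.
have [r1|r1] := ltP 0 r; first by exists r => //; split=> //; rewrite lerDl ltW.
have -> : r = 0 by apply/eqP; rewrite eq_le r1 r0.
have [->|s0] := eqVneq s 0.
  by exists 1 => //; split=> //; rewrite !powRr0 lerDl ltW.
exists (e `^ s^-1); first exact: powR_gt0.
split; first exact: powR_ge0.
by rewrite -powRrM mulVf// powRr1 ?(ltW e0)// powR0// add0r.
Qed.

Lemma content_window_neq0 :
  hausdorff_content s [set x | exists2 d, window a 0 d & x = pierce_point d] != 0%E.
Proof.
apply/eqP => /content0P.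
have C0 : 0 < C 0%N by apply: lt_le_trans (bound_ge1 0%N).
move=> /(_ (2 * C 0%N)^-1)[|U KU Us]; first by rewrite invr_gt0 mulr_gt0.
(* The s-sum is below e, and the errors add up to e as well: the total mass is
   below 2 e C 0 = 1. *)
pose e : R := (2 * C 0%N)^-1.
have e0 : 0 < e by rewrite invr_gt0 mulr_gt0.
have [J JP] : {J : nat -> nat & forall i, ((mass a 0 (J i) (U i))%:E <=
    (C 0%N)%:E * (diam_pow s (U i) + (e / (2 ^ i.+1)%:R)%:E))%E}.
  apply: (@choice _ _ (fun i j => ((mass a 0 j (U i))%:E <=
    (C 0%N)%:E * (diam_pow s (U i) + (e / (2 ^ i.+1)%:R)%:E))%E)) => i.
  by apply: mass_le_diam_pow; rewrite divr_gt0// ltr0n expn_gt0.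
have [|d dw dU] := escape_small_mass a a_ge2 a_growth 0 J U.
  apply: (@le_lt_trans _ _ ((C 0%N)%:E *
    \sum_(0 <= i <oo) (diam_pow s (U i) + (e / (2 ^ i.+1)%:R)%:E))%E).
    rewrite -nneseriesZl; last first.
      by move=> i _; rewrite adde_ge0 ?diam_pow_ge0// lee_fin divr_ge0// ltW.
    by apply: lee_nneseries => [i _ _|i _]; [rewrite lee_fin mass_ge0|exact: JP].
  apply: (@lt_le_trans _ _ ((C 0%N)%:E * (e%:E + e%:E))%E).
    rewrite lte_pmul2l//.
    apply: (le_lt_trans (epsilon_trick _ _ _)) => [i|//|].
    - exact: diam_pow_ge0.
    - exact: ltW.
    - by rewrite lteD2rE.
  by rewrite -EFinD -EFinM lee_fin /e le_eqVlt; apply/orP; left; apply/eqP; field; lra.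
have [i _ Ui] : (\bigcup_i U i) (pierce_point d) by apply: KU; exists d.
exact: (dU i).
Qed.

End frostman.

(** * The lower bound *)

Section lower.
Context {R : realType} (phi : nat -> R).
Hypothesis phi_gt0 : forall n : nat, (1 <= n)%N -> 0 < phi n.
Hypothesis phi_gap : phi n.+1 - phi n @[n --> \oo] --> +oo.

Let S := phi_sum phi.

Section digits.
Variable N : nat.
(** The conditions on the starting level N: room for the prefix 2, ..., N + 1
    below the digit windows, and separation of consecutive windows. *)
Hypothesis phi_N : N.+1%:R <= phi N.+1.
Hypothesis gap_N : forall n, (N <= n)%N -> phi n + ln 8 <= phi n.+1.

Definition low_digit k := (Num.truncn (expR (phi (N + k).+1))).+1.

Lemma low_digit_gt k : expR (phi (N + k).+1) < (low_digit k)%:R.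
Proof. exact: truncnS_gt. Qed.

Lemma low_digit_le k : (low_digit k)%:R <= 2 * expR (phi (N + k).+1).
Proof.
have e1 : 1 <= expR (phi (N + k).+1) by rewrite -expR0 ler_expR ltW// phi_gt0.
have : (Num.truncn (expR (phi (N + k).+1)))%:R <= expR (phi (N + k).+1).
  by rewrite truncn_le expR_ge0.
rewrite /low_digit -natr1; lra.
Qed.

Lemma low_digit_ge2 k : (2 <= low_digit k)%N.
Proof. by rewrite ltnS truncn_gt0 -expR0 ler_expR ltW// phi_gt0. Qed.

Lemma low_digit_growth k : (4 * low_digit k <= low_digit k.+1)%N.
Proof.
rewrite -(ler_nat R) natrM; apply: le_trans (ltW (low_digit_gt _)).
have Nk : (N <= (N + k).+1)%N by lia.
have gap : expR (phi (N + k).+1) * 8 <= expR (phi (N + k).+2).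
  by rewrite -[8]lnK ?posrE// -expRD ler_expR; exact: gap_N.
by have := low_digit_le k; rewrite addnS; lra.
Qed.

(** The prefix 2, ..., N + 1 leads, with strictly increasing digits, to the
    level from which the windows are admissible. *)
Definition extend (d : nat -> nat) : nat -> nat :=
  fun i => if (i < N)%N then i.+2 else d (i - N)%N.

Lemma extend_shift d : (fun i => extend d (N + i)%N) = d.
Proof. by apply/funext => i; rewrite /extend ltnNge leq_addr/= addKn. Qed.

Lemma extend_code d : window low_digit 0 d -> pierce_code (extend d).
Proof.
move=> dw; have [_ dS] := window_code _ low_digit_ge2 low_digit_growth _ _ dw.
have d0 : (N.+1 < d 0)%N.
  have /andP[+ _] := dw 0%N; apply: leq_trans; rewrite -(ltr_nat R).
  apply: lt_trans (low_digit_gt _); rewrite !addn0.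
  have := expR_gt1Dx (lt0r_neq0 (phi_gt0 _ (ltn0Sn N))) => h.
  move: phi_N => h'; lra.
split; first by rewrite /extend; case: ifPn => // _; rewrite sub0n; lia.
move=> i; rewrite /extend; case: ifPn => iN; case: ifPn => iN1 //; try lia.
  have -> : (i.+1 - N)%N = 0%N by lia.
  by apply: leq_trans d0; lia.
by rewrite subSn ?dS//; lia.
Qed.

Lemma extend_pierce_E d : window low_digit 0 d ->
  pierce_E phi (pierce_point (extend d)).
Proof.
move=> dw; have ec := extend_code _ dw; split; last split.
- have /andP[x0 x1] := @pierce_point_itv R _ (pierce_code_ge2 _ ec).
  by rewrite x0 ltW.
- exact: irrational_pierce_point.
apply/cvgrPdist_le => e e0; have [M HM] := phi_superlinear _ phi_gt0 phi_gap (ln 4 / e).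
exists (maxn M N.+1) => // -[|n] /=; rewrite geq_max => /andP[Mn Nn]; first by [].
rewrite pierce_digit_point// -pmulrn.
have p0 : 0 < phi n.+1 by exact: phi_gt0.
have l4 : 0 <= ln 4 :> R by rewrite ln_ge0//; lra.
have pe : ln 4 <= e * phi n.+1.
  rewrite mulrC -ler_pdivrMr//; apply: le_trans (HM _ Mn).
  by rewrite ler_peMr ?divr_ge0 ?(ltW e0)// ler1n.
have /andP[d1 d2] : (low_digit (n - N) <= extend d n < 2 * low_digit (n - N))%N.
  by have := dw (n - N)%N; rewrite add0n /extend [(n < N)%N]ltnNge (Nn : (N <= n)%N).
have nE : (N + (n - N)).+1 = n.+1 by lia.
have dg : 0 < (extend d n)%:R :> R.
  by rewrite ltr0n (leq_trans _ d1).
have l1 : phi n.+1 <= ln (extend d n)%:R.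
  rewrite -ler_expR lnK ?posrE//; have := low_digit_gt (n - N); rewrite nE => /ltW/le_trans->//.
  by rewrite ler_nat.
have l2 : ln (extend d n)%:R <= phi n.+1 + ln 4.
  rewrite -ler_expR expRD !lnK ?posrE//.
  have := low_digit_le (n - N); rewrite nE.
  move/ltnW : d2; rewrite -(ler_nat R) natrM; lra.
rewrite ler_norml; apply/andP; split.
  by rewrite lerBrDl lerBlDr ler_pdivrMr// mulrDl; lra.
by rewrite lerBlDr -lerBlDl ler_pdivlMr// mulrBl; lra.
Qed.

(** Every suffix of the extended sequences gives a set which is an affine
    inverse image of the previous one, the digit removed being k + 2. *)
Lemma content_window_extend s : 0 <= s ->
  hausdorff_content s (pierce_E phi) = 0%E ->
  hausdorff_content s [set x : R | exists2 d, window low_digit 0 d &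
                                 x = pierce_point d] = 0%E.
Proof.
move=> s0 E0.
pose B k := [set x : R | exists2 d, window low_digit 0 d &
  x = pierce_point (fun i => extend d (k + i)%N)].
suff H k : (k <= N)%N -> hausdorff_content s (B k) = 0%E.
  rewrite -[RHS](H N)//; congr (hausdorff_content s _).
  by apply/seteqP; split=> x [d dw ->]; exists d => //; rewrite extend_shift.
elim: k => [_|k IH kN]; apply/eqP; rewrite eq_le outer_measure_ge0 andbT.
  rewrite -[leRHS]E0; apply: le_outer_measure => _ [d dw ->].
  exact: extend_pierce_E.
apply: (@le_trans _ _ (hausdorff_content s
    [set y | B k (- k.+2%:R^-1 * y + k.+2%:R^-1)])).
  apply: le_outer_measure => _ [d dw ->]; exists d => //.
  have [kc _] := @iter_pierce_map_point R _ k (extend_code _ dw).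
  rewrite (pierce_pointS _ (pierce_code_ge2 _ kc)) addn0.
  have -> : extend d k = k.+2 by rewrite /extend kN.
  have -> : dshift (fun i => extend d (k + i)) = (fun i => extend d (k.+1 + i)%N).
    by apply/funext => i; rewrite /dshift addnS.
  by ring.
apply: (le_trans (content_affine _ _ _ _ s0 _)).
  by rewrite oppr_eq0 invr_eq0 pnatr_eq0.
by rewrite (IH (ltnW kN)) mule0.
Qed.

End digits.

Lemma exp2_le_expR n : 2 ^+ n <= expR n%:R :> R.
Proof.
elim: n => [|n IH]; first by rewrite expR0.
rewrite exprSr -[n.+1%:R]natr1 expRD ler_pM//.
by have := expR_ge1Dx (1 : R); lra.
Qed.

(** With C n = exp ((1 - s) S_(N+n)) / 2^n, the step hypothesis of the mass
    distribution principle holds because the number a n of digits exceeds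
    exp (phi), and the lower bound on C n amounts to S_M - s S_(M+1) growing
    faster than n, where M = N + n; this is where s rho < 1 enters. *)
Lemma content_pierce_E_neq0 s rho N0 : 0 <= s -> s <= 1 -> s * rho < 1 ->
  (forall n, (N0 <= n)%N -> S n.+1 <= rho * S n) ->
  hausdorff_content s (pierce_E phi) != 0%E.
Proof.
move=> s0 s1 srho Srho; apply/eqP => E0.
have [N1 H1] := phi_gap_ge _ phi_gap (ln 8).
have [N2 H2] := phi_superlinear _ phi_gt0 phi_gap 1.
pose q := 1 - s * rho; have q0 : 0 < q by rewrite subr_gt0.
have [N3 H3] := phi_sum_superlinear _ phi_gt0 phi_gap (6 / q).
(* The slope 6 / q leaves a margin of 6 M >= n + 5, which pays for the factor
   32 * 2 ^+ n <= exp (n + 5). *)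
pose N := (N0 + N1 + N2 + N3).+1.
have phiN : N.+1%:R <= phi N.+1.
  by rewrite -[leLHS]mul1r; apply: H2; rewrite /N; lia.
have gapN n : (N <= n)%N -> phi n + ln 8 <= phi n.+1.
  by move=> Nn; apply: H1; move: Nn; rewrite /N; lia.
pose a := low_digit N.
pose C n := expR ((1 - s) * S (N + n)) / 2 ^+ n.
have W0 := content_window_extend N phiN gapN s s0 E0.
suff : hausdorff_content s [set x : R | exists2 d, window a 0 d &
    x = pierce_point d] != 0%E by rewrite W0 eqxx.
apply: (content_window_neq0 a s C) => //.
- exact: low_digit_ge2.
- exact: low_digit_growth.
- move=> n; set M := (N + n)%N.
  have x0 : 0 < expR (phi M.+1) by exact: expR_gt0.
  apply: (@le_trans _ _ (32 * expR (s * phi M.+1))).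
    apply: (@le_trans _ _ ((32 * expR (phi M.+1)) `^ s)).
      rewrite ge0_ler_powR ?nnegrE ?mulr_ge0 ?expR_ge0//.
      by have := low_digit_le N n; rewrite -/a -/M; lra.
    rewrite powRM ?(ltW x0)// -expRM [phi _ * s]mulrC ler_wpM2r ?expR_ge0//.
    by rewrite -[leRHS]powRr1// ler_powR//; lra.
  rewrite /C ler_pdivlMr ?exprn_gt0// mulrAC.
  have h32 : 32 * 2 ^+ n <= expR (n + 5)%:R :> R.
    apply: le_trans (exp2_le_expR _); rewrite exprD mulrC; lra.
  apply: (le_trans (ler_wpM2r (expR_ge0 _) h32)).
  rewrite -expRD ler_expR.
  have h3 : 6 / q * M%:R <= S M by apply: H3; rewrite /M /N; lia.
  have h0 : S M.+1 <= rho * S M by apply: Srho; rewrite /M /N; lia.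
  have h0' : s * S M.+1 <= s * (rho * S M) by rewrite ler_wpM2l.
  rewrite /S phi_sumS -/S in h0'.
  have h3' : 6 * M%:R <= q * S M.
    have -> : 6 * M%:R = q * (6 / q * M%:R) by field; rewrite gt_eqF.
    by rewrite ler_pM2l.
  have h4 : (n + 5)%:R <= 6 * M%:R :> R by rewrite -natrM ler_nat /M /N; lia.
  move: h3'; rewrite /q /S; rewrite /S in h0'; lra.
- move=> n; set M := (N + n)%N.
  have a0 : 0 < (a n)%:R :> R by rewrite ltr0n.
  have -> : C n.+1 = C n * expR ((1 - s) * phi M.+1) / 2.
    rewrite /C addnS /S phi_sumS mulrDr expRD exprS -/M.
    by field; rewrite expf_neq0.
  have : 0 <= C n by rewrite divr_ge0 ?expR_ge0 ?exprn_ge0.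
  move: (C n) => c c0; rewrite -!mulrA ler_wpM2l//.
  have h1 : expR ((1 - s) * phi M.+1) <= (a n)%:R `^ (1 - s).
    rewrite mulrC expRM ge0_ler_powR ?nnegrE ?expR_ge0 ?subr_ge0// ltW//.
    exact: low_digit_gt.
  have h2 : (2 * (a n)%:R) `^ s <= 2 * (a n)%:R `^ s.
    rewrite powRM// ler_wpM2r ?powR_ge0// -[leRHS]powRr1// ler_powR//; lra.
  have aE : (a n)%:R = (a n)%:R `^ (1 - s) * (a n)%:R `^ s :> R.
    by rewrite -powRD ?subrK ?powRr1// gt_eqF ?implybT// a0.
  rewrite [leRHS]aE ler_pM ?expR_ge0 ?mulr_ge0 ?invr_ge0 ?powR_ge0//.
  by rewrite ler_pdivrMl.
Qed.

End lower.

(** * The dimension formula *)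

Section limsup.
Context {R : realType}.
Implicit Types u : nat -> \bar R.

Lemma limn_esup_gt_freq u (r : R) : (r%:E < limn_esup u)%E ->
  forall N, exists2 m, (N <= m)%N & (r%:E < u m)%E.
Proof.
move=> ru N; have : (limn_esup u <= ereal_sup (u @` [set n | (N <= n)%N]))%E.
  by apply: ereal_inf_lbound; exists [set n | (N <= n)%N] => //; exists N.
by move=> /(lt_le_trans ru)/ereal_sup_gt[_ [m Nm <-] rm]; exists m.
Qed.

Lemma limn_esup_lt_near u (r : R) : (limn_esup u < r%:E)%E ->
  exists N, forall n, (N <= n)%N -> (u n < r%:E)%E.
Proof.
move=> /ereal_inf_lt[_ [V [N _ NV] <-] Vr]; exists N => n Nn.
by apply: le_lt_trans Vr; apply: ereal_sup_ubound; exists n => //; exact: NV.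
Qed.

End limsup.

Theorem corollary1p5 (R : realType) (phi : nat -> R)
  (phi_gt0 : forall n : nat, (1 <= n)%N -> 0 < phi n)
  (phi_nd : forall m n : nat, (1 <= m)%N -> (m <= n)%N -> phi m <= phi n)
  (phi_gap : phi n.+1 - phi n @[n --> \oo] --> +oo) :
  hausdorff_dim (pierce_E phi) = ((1 + pierce_xi phi)^-1)%E.
Proof.
have xi0 : (0 <= pierce_xi phi)%E.
  rewrite leNgt; apply/negP => /limn_esup_lt_near[N /(_ N (leqnn N))].
  by rewrite lte_fin ltNge divr_ge0// ?phi_sum_ge0// ltW// phi_gt0.
have upper s rho : 0 < s -> 1 < s * rho -> ((rho - 1)%:E < pierce_xi phi)%E ->
    (hausdorff_dim (pierce_E phi) <= s%:E)%E.
  move=> s0 srho /limn_esup_gt_freq freq.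
  apply: ereal_inf_lbound; exists s => //; split; first exact: ltW.
  apply: content0_hausdorff0 => //.
  apply: (content_pierce_E0 _ phi_gt0 phi_gap s rho) => // N.
  have [[|m]// Nm] := freq N.+1 => H; exists m.+1; first exact: ltnW.
  move: H; rewrite lte_fin ltr_pdivlMr ?phi_sum_gt0// [phi_sum _ m.+2]phi_sumS.
  rewrite -/(phi_sum phi m.+1) => h; lra.
have lower s rho : 0 <= s -> s <= 1 -> s * rho < 1 ->
    (pierce_xi phi < (rho - 1)%:E)%E ->
    hausdorff_measure s (pierce_E phi) != 0%E.
  move=> s0 s1 srho /limn_esup_lt_near[N HN].
  have := content_pierce_E_neq0 _ phi_gt0 phi_gap s rho N.+1 s0 s1 srho.
  move=> H; apply/eqP => /hausdorff0_content0/eqP; apply/negP; apply: H.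
  move=> [//|n Nn]; have := HN n.+1 (leq_trans (leqnSn _) Nn).
  rewrite lte_fin ltr_pdivrMr ?phi_sum_gt0// [phi_sum _ n.+2]phi_sumS.
  rewrite -/(phi_sum phi n.+1) => h; lra.
move: upper lower xi0; case: (pierce_xi phi) => [x| |]// upper lower xi0.
  rewrite lee_fin in xi0; have x1 : 0 < 1 + x by lra.
  rewrite -EFinD inver gt_eqF//; apply/eqP; rewrite eq_le; apply/andP; split.
    apply/lee_addgt0Pr => e e0; rewrite -EFinD.
    have i0 : 0 < (1 + x)^-1 by rewrite invr_gt0.
    (* rho is the midpoint of 1 / s < 1 + x. *)
    set s := (1 + x)^-1 + e; have s0 : 0 < s by rewrite addr_gt0.
    have sx : s^-1 < 1 + x.
      by rewrite -[ltRHS]invrK ltf_pV2 ?posrE// ltrDl.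
    have ss : s * s^-1 = 1 by rewrite divff// gt_eqF.
    apply: (upper s ((s^-1 + (1 + x)) / 2)) => //; last by rewrite lte_fin; lra.
    rewrite -[X in X < _]ss ltr_pM2l//; lra.
  apply: le_ereal_inf_tmp => _ [s [s0 sE] <-]; rewrite lee_fin leNgt; apply/negP => sx.
  have sx1 : s * (1 + x) < 1 by rewrite -ltr_pdivlMr// mul1r.
  have s1 : s < 1 by nra.
  (* The increment 1 - s (1 + x) works because s < 1. *)
  have := lower s (1 + x + (1 - s * (1 + x))) s0 (ltW s1).
  rewrite sE eqxx => H; suff : false by []; apply: H; last by rewrite lte_fin; lra.
  nra.
rewrite addey// invey; apply/eqP; rewrite eq_le; apply/andP; split.
  apply/lee_addgt0Pr => e e0; rewrite add0e.
  apply: (upper e (2 / e)) => //; last by rewrite ltry.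
  by rewrite mulrC divfK ?gt_eqF//; lra.
by apply: le_ereal_inf_tmp => _ [s [s0 _] <-]; rewrite lee_fin.
Qed.
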